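(* Let $F,G\in\mathbb{R}^{m\times m}$ with $\det F=0$ and with $sF-G$ a regular pencil, let $C\in\mathbb{R}^{\ell\times m}$, and let $P_2,Q_q,H_q,q,q_*$ be as given by the Weierstrass decomposition of $sF-G$ described in the context. Consider the singular discrete time system $$FY_{k+1}=GY_k+V_k,\quad k=0,1,2,\dots\qquad (\mathrm{S})$$ with state $Y_k\in\mathbb{R}^m$, input $V_k\in\mathbb{R}^m$, known initial condition $Y_0$ and output $X_k=CY_k$. Then: (a) For system (S), causality between state and inputs exists if and only if there exists a matrix $B\in\mathbb{R}^{m\times r_1}$ such that $V_k=BU_k$, where $U_k\in\mathbb{R}^{r_1}$, and $H_qP_2B=0_{q,r_1}$. (b) For system (S), with the input written as $V_k=BU_k$, where $B\in\mathbb{R}^{m\times r_1}$ and $U_k\in\mathbb{R}^{r_1}$, causality between output and input exists if and only if every column of the matrix $$\left[\begin{array}{ccc}Q_qH_qP_2B&\cdots&Q_qH_q^{q_*-1}P_2B\end{array}\right]$$ lies in the right nullspace of $C$. (c) Let $0<n<1$ or $1<n<2$. The singular fractional discrete time system $$F\nabla_0^nY_k=GY_k+V_k,\quad k=1,2,\dots,$$ is characterized by the property of causality, i.e. it is causal.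
   Context: Regular pencil: for square $F,G\in\mathbb{R}^{m\times m}$, the pencil $sF-G$ is regular if $\det(sF-G)$ is not identically zero as a polynomial in $s$. Its finite eigenvalues are the roots of $\det(sF-G)$. Weierstrass decomposition: by regularity there exist nonsingular matrices $P,Q\in\mathbb{R}^{m\times m}$ such that $$PFQ=\left[\begin{array}{cc} I_p&0_{p,q}\\0_{q,p}&H_q\end{array}\right],\qquad PGQ=\left[\begin{array}{cc} J_p&0_{p,q}\\0_{q,p}&I_q\end{array}\right],$$ where $p+q=m$, $p$ is the sum of the algebraic multiplicities of the finite eigenvalues, $q$ is the algebraic multiplicity of the infinite eigenvalue, $J_p$ is a Jordan matrix, and $H_q$ is a nilpotent matrix of index $q_*$ (the least positive integer with $H_q^{q_*}=0$). Write $Q=[\,Q_p\ \ Q_q\,]$ with $Q_p\in\mathbb{R}^{m\times p}$, $Q_q\in\mathbb{R}^{m\times q}$, and $P=\left[\begin{array}{c}P_1\\P_2\end{array}\right]$ with $P_1\in\mathbb{R}^{p\times m}$, $P_2\in\mathbb{R}^{q\times m}$. $0_{a,b}$ denotes the $a\times b$ zero matrix. Causality: a system is called causal (causality between state and inputs) if its state $Y_k$, for any $k>0$, is determined completely by the initial state $Y_0$ and the former inputs $V_0,V_1,\dots,V_k$; otherwise it is called non-causal. Causality between output and input means the same with the output $X_k=CY_k$ in place of the state $Y_k$. Fractional difference: the raising power is $k^{\overline{\alpha}}=\Gamma(k+\alpha)/\Gamma(k)$, and the nabla Riemann–Liouville fractional operator of a sequence $(Y_k)_{k\ge0}$ in $\mathbb{R}^m$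 is $$\nabla_0^{-n}Y_k=\frac{1}{\Gamma(n)}\sum_{j=0}^{k}(k-j+1)^{\overline{n-1}}Y_j,$$ with $\nabla_0^{n}$ obtained by replacing $n$ by $-n$: $\nabla_0^{n}Y_k=\frac{1}{\Gamma(-n)}\sum_{j=0}^{k}(k-j+1)^{\overline{-n-1}}Y_j$.
   Formalization: Part (c) is proved under the added assumption that 1 is not a finite eigenvalue of sF-G (det(F-G)≠0); without it (c) always fails, e.g. F=diag(1,0), G=I. In (a) the inputs take values in a set containing 0. *)

(* Defs.v *)
From mathcomp Require Import all_boot all_order all_algebra.
From mathcomp Require Import all_classical all_reals all_analysis.

Set Implicit Arguments.
Unset Strict Implicit.
Unset Printing Implicit Defensive.

Import Order.TTheory GRing.Theory Num.Theory.

Local Open Scope classical_set_scope.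
Local Open Scope ring_scope.

(** * Pencils and the Weierstrass decomposition *)

(* det (s F - G), as a polynomial in the indeterminate s = 'X. *)
Definition pencil_poly (R : realType) (m : nat) (F G : 'M[R]_m) : {poly R} :=
  \det ('X *: map_mx polyC F - map_mx polyC G).

Definition regular_pencil (R : realType) (m : nat) (F G : 'M[R]_m) : Prop :=
  pencil_poly F G != 0.

Definition finite_eigenvalue (R : realType) (m : nat) (F G : 'M[R]_m) (s : R)
  : Prop := root (pencil_poly F G) s.

Definition jordan_block (R : realType) (k : nat) (a : R) : 'M[R]_k :=
  \matrix_(i, j) (if i == j then a else (i.+1 == j)%:R).

(* The real Jordan block of a conjugate pair a +/- ib: 2x2 blocks
   [a b; -b a] on the diagonal and 2x2 identities just above it. Row and column
   2u + e (e = 0, 1) is entry e of the block of index u. *)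
Definition jordan_pair_block (R : realType) (k : nat) (a b : R)
  : 'M[R]_(k.*2) :=
  \matrix_(i, j)
    (if i./2 == j./2 then
       if odd i == odd j then a else if odd j then b else - b
     else (((i./2).+1 == j./2) && (odd i == odd j))%:R).

(* Direct sums of Jordan blocks. A real pencil may have non-real eigenvalues, so
   a Jordan matrix with real entries is a real Jordan form; when all eigenvalues
   are real this is the usual Jordan form. *)
Inductive jordan_matrix (R : realType) : forall p : nat, 'M[R]_p -> Prop :=
| jordan_nil (J : 'M[R]_0) : jordan_matrix J
| jordan_cons k a p (J : 'M[R]_p) :
    jordan_matrix J ->
    jordan_matrix (block_mx (jordan_block k a) 0 0 J)
| jordan_cons_pair k a b p (J : 'M[R]_p) :
    b != 0 -> jordan_matrix J ->
    jordan_matrix (block_mx (jordan_pair_block k a b) 0 0 J).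

Definition nilpotency_index (R : realType) (q : nat) (H : 'M[R]_q) (d : nat)
  : Prop :=
  [/\ (0 < d)%N, H ^+ d = 0 &
      forall i : nat, (0 < i)%N -> H ^+ i = 0 -> (d <= i)%N].

(* P = col_mx P1 P2 and Q = row_mx Qp Qq are square because p + q = m; the casts
   only record this, so that unitmx applies. The sum of the algebraic
   multiplicities of the (complex) finite eigenvalues is the degree of
   det (s F - G). *)
Record weierstrass (R : realType) (m p q : nat) (F G : 'M[R]_m)
    (P1 : 'M[R]_(p, m)) (P2 : 'M[R]_(q, m))
    (Qp : 'M[R]_(m, p)) (Qq : 'M[R]_(m, q))
    (J : 'M[R]_p) (H : 'M[R]_q) (qs : nat) : Prop := Weierstrass {
  weier_dim : (p + q = m)%N ;
  weier_unitP : castmx (weier_dim, erefl m) (col_mx P1 P2) \in unitmx ;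
  weier_unitQ : castmx (erefl m, weier_dim) (row_mx Qp Qq) \in unitmx ;
  weier_F : col_mx P1 P2 *m F *m row_mx Qp Qq = block_mx 1%:M 0 0 H ;
  weier_G : col_mx P1 P2 *m G *m row_mx Qp Qq = block_mx J 0 0 1%:M ;
  weier_mult : size (pencil_poly F G) = p.+1 ;
  weier_jordan : jordan_matrix J ;
  weier_index : nilpotency_index H qs }.

(** * Systems and causality *)

(* A system is given by its trajectories: the pairs (Y, V) of a state sequence
   and an admissible input sequence which solve it. *)
Definition dsystem (R : realType) (m : nat) : Type :=
  (nat -> 'cV[R]_m) -> (nat -> 'cV[R]_m) -> Prop.

Definition singular_system (R : realType) (m : nat) (F G : 'M[R]_m)
  : dsystem R m :=
  fun Y V => forall k : nat, F *m Y k.+1 = G *m Y k + V k.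

Definition restrict_input (R : realType) (m : nat) (S : dsystem R m)
    (inputs : set (nat -> 'cV[R]_m)) : dsystem R m :=
  fun Y V => S Y V /\ inputs V.

(* Sequences V with V_k = B U_k for a sequence U_k in R^r. *)
Definition inputs_through (R : realType) (m r : nat) (B : 'M[R]_(m, r))
  : set (nat -> 'cV[R]_m) :=
  [set V | exists U : nat -> 'cV[R]_r, forall k, V k = B *m U k].

Definition inputs_in (R : realType) (m : nat) (W : set 'cV[R]_m)
  : set (nat -> 'cV[R]_m) :=
  [set V | forall k, W (V k)].

(* "Y_k is determined by Y_0, V_0, ..., V_k": two trajectories which agree on
   these data have the same state at time k. *)
Definition causal_state (R : realType) (m : nat) (S : dsystem R m) : Prop :=
  forall Y V Y' V', S Y V -> S Y' V' -> Y 0%N = Y' 0%N ->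
  forall k : nat, (0 < k)%N -> (forall i : nat, (i <= k)%N -> V i = V' i) ->
  Y k = Y' k.

Definition causal_output (R : realType) (m l : nat) (C : 'M[R]_(l, m))
    (S : dsystem R m) : Prop :=
  forall Y V Y' V', S Y V -> S Y' V' -> Y 0%N = Y' 0%N ->
  forall k : nat, (0 < k)%N -> (forall i : nat, (i <= k)%N -> V i = V' i) ->
  C *m Y k = C *m Y' k.

(** * The nabla fractional difference *)

(* Euler's integral, for x > 0. *)
Definition Gamma_pos (R : realType) (x : R) : R :=
  \int[@lebesgue_measure R]_(t in `]0, +oo[) (t `^ (x - 1) * expR (- t)).

(* Extended to negative non-integers by Gamma (x + 1) = x Gamma x: with
   N = - floor x, 0 < x + N < 1 and
   Gamma x = Gamma (x + N) / (x (x + 1) ... (x + N - 1)).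
   The values at the poles 0, -1, -2, ... are meaningless. *)
Definition Gamma (R : realType) (x : R) : R :=
  if 0 < x then Gamma_pos x
  else let N := `|Num.floor x|%N in
       Gamma_pos (x + N%:R) / \prod_(i < N) (x + i%:R).

Definition raising_power (R : realType) (x a : R) : R :=
  Gamma (x + a) / Gamma x.

(* nabla_0^{-nu} Y_k; the fractional difference nabla_0^n is the case
   nu = - n. *)
Definition nabla_sum (R : realType) (m : nat) (nu : R) (Y : nat -> 'cV[R]_m)
    (k : nat) : 'cV[R]_m :=
  (Gamma nu)^-1 *:
    \sum_(0 <= j < k.+1) raising_power (k - j + 1)%:R (nu - 1) *: Y j.

Definition nabla (R : realType) (m : nat) (n : R) (Y : nat -> 'cV[R]_m)
    (k : nat) : 'cV[R]_m :=
  nabla_sum (- n) Y k.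

Definition fractional_system (R : realType) (m : nat) (n : R) (F G : 'M[R]_m)
  : dsystem R m :=
  fun Y V => forall k : nat, (0 < k)%N -> F *m nabla n Y k = G *m Y k + V k.

(* Main.v *)
Require Import Defs.
From mathcomp Require Import all_boot all_order all_algebra.
From mathcomp Require Import all_classical all_reals all_analysis.
From mathcomp Require Import measurable_realfun lra.

Import Order.TTheory GRing.Theory Num.Theory.
Import numFieldNormedType.Exports.

Local Open Scope classical_set_scope.
Local Open Scope ring_scope.

(** Let Zp and Zq be the block rows of the inverse of [Qp Qq]. In the
    coordinates (Zp Y, Zq Y) the singular system splits into a slow part
      Zp Y_{k+1} = J (Zp Y_k) + P1 V_k,
    an ordinary recursion which V_0, ..., V_{k-1} determine, and a fast part
      H (Zq Y_{k+1}) = Zq Y_k + P2 V_k,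
    which nilpotency of H forces to run backwards in time:
      Zq Y_k = - sum_{i < d} H^i P2 V_{k+i}   whenever H^d = 0.
    The terms with i > 0 look at future inputs, so the output C Y is causal as
    soon as C Qq H^i P2 annihilates every admissible input vector for i > 0.
    Conversely, fix k >= d with k > 0, and drive the system by the input which
    is w at time k + i and 0 at all other times. Its response starts from
    Y_0 = 0, since the impulse lies too far ahead to be seen at time 0, but at
    time k its output is - C Qq H^i P2 w, although all inputs up to that time
    are 0. Comparing with the zero trajectory, causality forces this vector to
    vanish. This is [causal_outputP].

    Statement (b) is this criterion when the admissible input vectors form the
    range of B. Statement (a) is the case where C is the identity: Qq has the
    left inverse Zq, so the condition for i = 1 already says H P2 w = 0 and
    implies the others. A matrix B whose range is the kernel of H P2 then
    represents all admissible inputs.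

    For (c), the coefficient of Y_k in nabla^n Y_k is 1, because Gamma (-n) is
    nonzero and Gamma 1 = 1. Hence the equation at time k reads
    (F - G) Y_k = V_k - F (a combination of Y_0, ..., Y_{k-1}), and F - G is
    invertible as soon as 1 is not a finite eigenvalue. *)

(** * Splitting the pencil *)

Set Implicit Arguments.
(** Zp and Zq are the block rows of the inverse of [Qp Qq]. With them the
    decomposition can be used without inverse matrices and without the casts
    along p + q = m: Qp Zp and Qq Zq are the complementary projections onto the
    slow and the fast subspace, and split_inj says that the rows of P1 and P2
    together test equality of vectors. *)
Record split_pencil {R : realType} {m p q : nat} (F G : 'M[R]_m)
    (P1 : 'M[R]_(p, m)) (P2 : 'M[R]_(q, m))
    (Qp : 'M[R]_(m, p)) (Qq : 'M[R]_(m, q))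
    (J : 'M[R]_p) (H : 'M[R]_q)
    (Zp : 'M[R]_(p, m)) (Zq : 'M[R]_(q, m)) : Prop := SplitPencil {
  split_sum : Qp *m Zp + Qq *m Zq = 1%:M ;
  split_pp : Zp *m Qp = 1%:M ;
  split_pq : Zp *m Qq = 0 ;
  split_qp : Zq *m Qp = 0 ;
  split_qq : Zq *m Qq = 1%:M ;
  split_P1F : P1 *m F = Zp ;
  split_P1G : P1 *m G = J *m Zp ;
  split_P2F : P2 *m F = H *m Zq ;
  split_P2G : P2 *m G = Zq ;
  split_inj : forall v : 'cV[R]_m, P1 *m v = 0 -> P2 *m v = 0 -> v = 0 }.
Unset Implicit Arguments.

Lemma weierstrass_split {R : realType} {m p q qs : nat} {F G : 'M[R]_m}
    {P1 : 'M[R]_(p, m)} {P2 : 'M[R]_(q, m)}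
    {Qp : 'M[R]_(m, p)} {Qq : 'M[R]_(m, q)} {J : 'M[R]_p} {H : 'M[R]_q} :
  weierstrass F G P1 P2 Qp Qq J H qs ->
  exists Zp Zq, split_pencil F G P1 P2 Qp Qq J H Zp Zq.
Proof.
case=> dim; case: m / dim F G P1 P2 Qp Qq => F G P1 P2 Qp Qq.
rewrite !castmx_id => uP uQ PFQ PGQ _ _ _.
pose Z := invmx (row_mx Qp Qq).
have ZQ : Z *m row_mx Qp Qq = block_mx 1%:M 0 0 1%:M.
  by rewrite -scalar_mx_block mulVmx.
have QZ : row_mx Qp Qq *m Z = 1%:M by rewrite mulmxV.
have PF : col_mx P1 P2 *m F = block_mx 1%:M 0 0 H *m Z.
  by rewrite -PFQ -!mulmxA QZ mulmx1.
have PG : col_mx P1 P2 *m G = block_mx J 0 0 1%:M *m Z.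
  by rewrite -PGQ -!mulmxA QZ mulmx1.
move: ZQ QZ PF PG; rewrite -[Z]vsubmxK; set Zp := usubmx Z; set Zq := dsubmx Z.
rewrite mul_col_row => /eq_block_mx[pp pq qp qq].
rewrite mul_row_col !mul_block_col !mul_col_mx !mul0mx !mul1mx addr0 !add0r.
move=> QZ /eq_col_mx[P1F P2F]; rewrite addr0 => /eq_col_mx[P1G P2G].
exists Zp, Zq; split=> // v P1v P2v.
have : col_mx P1 P2 *m v = 0 by rewrite mul_col_mx P1v P2v col_mx0.
by move/(congr1 (mulmx (invmx (col_mx P1 P2)))); rewrite mulKmx// mulmx0.
Qed.

(** * Causality of the singular system *)

Section SplitSystem.
Context {R : realType} {m p q : nat} {F G : 'M[R]_m}.
Context {P1 : 'M[R]_(p, m)} {P2 : 'M[R]_(q, m)}.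
Context {Qp : 'M[R]_(m, p)} {Qq : 'M[R]_(m, q)} {J : 'M[R]_p} {H : 'M[R]_q}.
Context {Zp : 'M[R]_(p, m)} {Zq : 'M[R]_(q, m)}.
Context (FG : split_pencil F G P1 P2 Qp Qq J H Zp Zq).

Lemma split_systemP Y V :
  singular_system F G Y V <->
  forall k, Zp *m Y k.+1 = J *m (Zp *m Y k) + P1 *m V k /\
            H *m (Zq *m Y k.+1) = Zq *m Y k + P2 *m V k.
Proof.
split=> [YV k|YV k].
  have Yk := YV k; split.
    have := congr1 (mulmx P1) Yk.
    by rewrite mulmxDr !mulmxA (split_P1F FG) (split_P1G FG).
  have := congr1 (mulmx P2) Yk.
  by rewrite mulmxDr !mulmxA (split_P2F FG) (split_P2G FG).
have [slow fast] := YV k.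
apply/eqP; rewrite -subr_eq0; apply/eqP/(split_inj FG).
  by rewrite mulmxBr mulmxDr !mulmxA (split_P1F FG) (split_P1G FG) slow
             -mulmxA subrr.
by rewrite mulmxBr mulmxDr !mulmxA (split_P2F FG) (split_P2G FG) -mulmxA fast
           subrr.
Qed.

Lemma slow_determined Y V Y' V' k :
    singular_system F G Y V -> singular_system F G Y' V' ->
    Y 0%N = Y' 0%N -> (forall i, (i < k)%N -> V i = V' i) ->
  Zp *m Y k = Zp *m Y' k.
Proof.
move=> /split_systemP YV /split_systemP YV' Y0.
elim: k => [|k IHk] VV'; first by rewrite Y0.
by rewrite (YV k).1 (YV' k).1 IHk ?VV'// => i ik; rewrite VV'// ltnW.
Qed.

(** Reading the fast equation as Zq Y_k = H (Zq Y_{k+1}) - P2 V_k and iterating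
    it d times pushes the unknown state behind the factor H^d, which is 0 as
    soon as d reaches the nilpotency index. *)
Lemma fast_unroll Y V d k : singular_system F G Y V ->
  Zq *m Y k = H ^+ d *m (Zq *m Y (k + d)%N)
              - \sum_(i < d) H ^+ i *m P2 *m V (k + i)%N.
Proof.
move=> /split_systemP YV; elim: d => [|d IHd].
  by rewrite big_ord0 subr0 addn0 expr0 mul1mx.
have step : H ^+ d.+1 *m (Zq *m Y (k + d.+1)%N) =
    H ^+ d *m (Zq *m Y (k + d)%N) + H ^+ d *m P2 *m V (k + d)%N.
  by rewrite exprSr addnS -mulmxE -mulmxA (YV (k + d)%N).2 mulmxDr -!mulmxA.
by rewrite big_ord_recr/= step opprD addrACA subrr addr0.
Qed.

Definition impulse (K : nat) (w : 'cV[R]_m) (k : nat) : 'cV[R]_m :=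
  if k == K then w else 0.

(** Up to time K only the fast part moves, anticipating the impulse; after time
    K the fast part is at rest and the slow part evolves freely. *)
Definition impulse_response (K : nat) (w : 'cV[R]_m) (k : nat) : 'cV[R]_m :=
  if (k <= K)%N then - (Qq *m (H ^+ (K - k) *m (P2 *m w)))
  else Qp *m (J ^+ (k - K.+1) *m (P1 *m w)).

Lemma impulse_responseP K w :
  singular_system F G (impulse_response K w) (impulse K w).
Proof.
apply/split_systemP => k; rewrite /impulse_response /impulse.
case: (ltngtP k K) => [kK|Kk|->].
- rewrite ![Zp *m _]mulmxN ![Zq *m _]mulmxN !(mulmxA Zp) !(mulmxA Zq).
  rewrite (split_pq FG) (split_qq FG) !mul0mx !mulmx0 !mul1mx !oppr0 !addr0.
  by rewrite !mulmx0 -(subnSK kK) exprS -mulmxA mulmxN.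
- rewrite !(mulmxA Zp) !(mulmxA Zq) (split_pp FG) (split_qp FG).
  rewrite !mul0mx !mulmx0 !mul1mx !addr0.
  by rewrite subSn// exprS -mulmxA.
- rewrite ![Zp *m - _]mulmxN ![Zq *m - _]mulmxN !(mulmxA Zp) !(mulmxA Zq).
  rewrite (split_pp FG) (split_pq FG) (split_qp FG) (split_qq FG).
  by rewrite !subnn !mul0mx !mulmx0 !mul1mx oppr0 mulmx0 add0r addNr.
Qed.

(** The exponents start at 1 because H^0 multiplies the current input V_k, which
    belongs to the data that may determine Y_k. *)
Lemma causal_outputP {l} (C : 'M[R]_(l, m)) (W : set 'cV[R]_m) d :
    H ^+ d = 0 -> W 0 ->
  causal_output C (restrict_input (singular_system F G) (inputs_in W)) <->
  forall w, W w -> forall i, C *m (Qq *m (H ^+ i.+1 *m (P2 *m w))) = 0.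
Proof.
move=> Hd W0; split=> [caus w Ww i|CW].
  (* The outputs are compared at time d + 1, which is positive even if d = 0;
     as the impulse comes at least d steps after time 0, H^K = 0. *)
  pose K := (d.+1 + i.+1)%N.
  have WV : inputs_in W (impulse K w).
    by move=> k; rewrite /impulse; case: ifP.
  have YV : restrict_input (singular_system F G) (inputs_in W)
      (impulse_response K w) (impulse K w).
    by split=> //; apply: impulse_responseP.
  have ZZ : restrict_input (singular_system F G) (inputs_in W)
      (fun=> 0) (fun=> 0).
    by split=> // k; rewrite !mulmx0 addr0.
  have Y0 : impulse_response K w 0 = 0.
    rewrite /impulse_response leq0n subn0 /K addSn exprS exprD Hd.
    by rewrite mul0r mulr0 mul0mx mulmx0 oppr0.
  have V0 k : (k <= d.+1)%N -> impulse K w k = 0.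
    rewrite /impulse; case: eqP => // ->.
    by rewrite /K addnS ltnNge leq_addr.
  have := caus _ _ _ _ YV ZZ Y0 d.+1 isT V0.
  rewrite /impulse_response leq_addr addKn mulmx0 mulmxN => /eqP.
  by rewrite oppr_eq0 => /eqP.
move=> Y V Y' V' [YV WV] [YV' WV'] Y0 k k0 VV'.
have CY : forall Y V, singular_system F G Y V -> inputs_in W V ->
    C *m Y k = C *m (Qp *m (Zp *m Y k)) - C *m (Qq *m (P2 *m V k)).
  move=> {YV YV' WV WV' VV' Y0} {}Y {}V YV WV.
  rewrite -{1}[Y k]mul1mx -(split_sum FG) mulmxDl mulmxDr -!mulmxA.
  congr (_ + _).
  rewrite (fast_unroll Y V d.+1 k YV) exprS Hd mulr0 mul0mx sub0r !mulmxN.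
  congr (- _).
  rewrite big_ord_recl expr0 mul1mx addn0 !mulmxDr !mulmx_sumr big1 ?addr0//.
  by move=> i _; rewrite -mulmxA CW.
rewrite (CY _ _ YV WV) (CY _ _ YV' WV') VV'//.
by rewrite (slow_determined Y V Y' V' k YV YV' Y0)// => i /ltnW/VV'.
Qed.

End SplitSystem.

(** Together with [inputs_throughE], this makes both kinds of causality
    instances of [causal_outputP]. *)
Lemma causal_output1 {R : realType} {m} (S : dsystem R m) :
  causal_output 1%:M S <-> causal_state S.
Proof.
by split=> caus Y V Y' V' YV YV' Y0 k k0 VV';
  have := caus _ _ _ _ YV YV' Y0 k k0 VV'; rewrite !mul1mx.
Qed.

Lemma inputs_throughE {R : realType} {m r} (B : 'M[R]_(m, r)) :
  inputs_through B = inputs_in (range (mulmx B)).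
Proof.
apply/seteqP; split=> V.
  by move=> [U VU] k; exists (U k); rewrite ?VU.
move=> WV; have /choice[U VU] : forall k, exists u, V k = B *m u.
  by move=> k; have [u _ <-] := WV k; exists u.
by exists U.
Qed.

(** The transposes appear because kermx gives the kernel of the action on row
    vectors. *)
Lemma kernel_through {R : fieldType} {m r} (A : 'M[R]_(r, m)) :
  exists B : 'M[R]_(m, m), A *m B = 0 /\
    forall w : 'cV[R]_m, A *m w = 0 -> range (mulmx B) w.
Proof.
exists (kermx A^T)^T; split.
  by apply: trmx_inj; rewrite trmx_mul trmxK mulmx_ker trmx0.
move=> w Aw; have /sub_kermxP/submxP[D wD] : w^T *m A^T = 0.
  by rewrite -trmx_mul Aw trmx0.
by exists D^T => //; rewrite -trmx_mul -wD trmxK.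
Qed.

Lemma mulmx_cV_eq0 {R : nzSemiRingType} {r s} (A : 'M[R]_(r, s)) :
  A = 0 <-> forall u : 'cV[R]_s, A *m u = 0.
Proof.
split=> [-> u|A0]; first by rewrite mul0mx.
by apply/matrixP => i j; have := A0 (delta_mx j 0);
  rewrite -colE => /matrixP/(_ i 0); rewrite !mxE.
Qed.

Lemma mulmx_col_mxrow_eq0 {R : nzRingType} {l m t} {r : 'I_t -> nat}
    (C : 'M[R]_(l, m)) (B : forall i, 'M[R]_(m, r i)) :
  (forall j, C *m col j (\mxrow_i B i) = 0) <-> forall i, C *m B i = 0.
Proof.
split=> [CB|CB j].
  have : C *m \mxrow_i B i = 0.
    by apply/matrixP => a j; have /matrixP/(_ a 0) := CB j;
      rewrite colE mulmxA -colE !mxE.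
  by rewrite mul_mxrow -mxrow0 => /eq_mxrowP.
rewrite colE mulmxA mul_mxrow (_ : \mxrow_i _ = 0) ?mul0mx//.
by rewrite -mxrow0; apply/eq_mxrowP.
Qed.

(** * The Gamma function *)

Lemma continuous_expRN {R : realType} : continuous (fun t : R => expR (- t)).
Proof.
move=> t; apply: continuous_comp; last exact: continuous_expR.
exact: opp_continuous.
Qed.

Lemma measurable_expRN {R : realType} (D : set R) :
  measurable_fun D (fun t : R => expR (- t)).
Proof.
by apply: measurable_funTS; apply: continuous_measurable_fun;
  exact: continuous_expRN.
Qed.

Lemma integral_expRN_itvcy {R : realType} (a : R) :
  (\int[lebesgue_measure]_(t in `[a, +oo[) (expR (- t))%:E = (expR (- a))%:E)%E.
Proof.
rewrite (@ge0_continuous_FTC2y _ _ (fun t => - expR (- t)) _ 0) //.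
- by rewrite -EFinB sub0r opprK.
- by apply: continuous_subspaceT; exact: continuous_expRN.
- rewrite -oppr0; apply: cvgN; exact: cvgr_expR.
- by apply/cvg_at_right_filter; apply: cvgN; exact: continuous_expRN.
- by move=> t _; rewrite derive1E derive_val mulrN1 opprK.
Qed.

(** The antiderivative t^a / a bounds the integral over [1/(n+1), 1] by 1/a,
    uniformly in n; monotone convergence carries the bound over to ]0, 1], where
    the integrand may be unbounded. *)
Lemma integral_powR_itv01 {R : realType} (a : R) : 0 < a ->
  (\int[lebesgue_measure]_(t in `]0%R, 1%R]) (t `^ (a - 1))%:E <= (a^-1)%:E)%E.
Proof.
move=> a0.
have tail e : 0 < e < 1 ->
    (\int[lebesgue_measure]_(t in `[e, 1%R]) (t `^ (a - 1))%:E =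
     (a^-1 * 1 `^ a)%:E - (a^-1 * e `^ a)%:E)%E.
  move=> /andP[e0 e1].
  have pos t : e <= t -> 0 < t by exact: lt_le_trans.
  have dF (t b : R) : 0 < t -> derivable (@powR R ^~ b) t 1.
    by move=> t0; apply: derivable_powR; rewrite in_itv/= t0.
  have cF (t b : R) : 0 < t -> {for t, continuous (@powR R ^~ b)}.
    by move=> t0; apply/differentiable_continuous/derivable1_diffP/dF.
  apply: (@continuous_FTC2 _ _ (fun t => a^-1 * t `^ a)) => //.
  - apply: continuous_in_subspaceT => t; rewrite inE/= in_itv/=.
    by move=> /andP[/pos t0 _]; exact: cF.
  - split.
    + move=> t; rewrite in_itv/= => /andP[/ltW/pos t0 _].
      by apply: derivableM => //; exact: dF.
    + apply: cvg_at_right_filter; apply: cvgM; [exact: cvg_cst|exact: cF].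
    + apply: cvg_at_left_filter; apply: cvgM; [exact: cvg_cst|exact: cF].
  - move=> t; rewrite in_itv/= => /andP[/ltW/pos t0 _].
    rewrite derive1E deriveM// ?derive_cst ?scaler0 ?addr0; last exact: dF.
    rewrite -derive1E powR_derive1 ?in_itv/= ?t0//.
    by rewrite scalerA mulVf ?scale1r// gt_eqF.
rewrite itv_open_bnd_bigcup.
apply: (cvge_le _ (ge0_nondecreasing_set_cvg_integral _ _ _ _)) => //.
- (* For n = 0 the interval [1/(n+1), 1] is a single point. *)
  exists 1%N => // n /= n0; rewrite add0r tail; last first.
    by rewrite invr_gt0 ltr0n invf_lt1// ltr1n.
  rewrite powR1/= mulr1 -EFinB lee_fin gerBl mulr_ge0 ?powR_ge0//.
  by rewrite invr_ge0 ltW.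
- move=> n k nk; rewrite subsetEset; apply: subset_itvr.
  by rewrite bnd_simp lerD2l lef_pV2 ?posrE ?ltr0n// ler_nat ltnS.
- move=> n; apply/measurable_EFinP; apply: measurable_funTS.
  exact: measurable_powR.
- by move=> n t _; rewrite lee_fin powR_ge0.
Qed.

Section GammaPos.
Context {R : realType} (a : R).

Let f (t : R) := t `^ (a - 1) * expR (- t).

Let mf D : measurable_fun D (EFin \o f).
Proof.
apply/measurable_EFinP; apply: measurable_funM; last exact: measurable_expRN.
by apply: measurable_funTS; exact: measurable_powR.
Qed.

Let f_ge0 t : 0 <= f t.
Proof. by rewrite mulr_ge0 ?powR_ge0 ?expR_ge0. Qed.

(** Positivity includes convergence, because a divergent integral has the real
    value 0. The integrand is at most t^(a-1) on ]0, 1] and at most e^(-t) on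
    ]1, +oo[, and it is at least e^(-1) on ]0, 1]. The hypothesis a <= 1 makes
    t^(a-1) nonincreasing, which gives the last two bounds. *)
Lemma Gamma_pos_gt0 : 0 < a <= 1 -> 0 < Gamma_pos a.
Proof.
move=> /andP[a0 a1].
have U : [set` `]0 : R, +oo[] = `]0, 1] `|` `]1, +oo[.
  by apply: itv_bndbnd_setU; rewrite bnd_simp.
apply: fine_gt0; apply/andP; split.
  apply: (@lt_le_trans _ _ (expR (- 1))%:E); first by rewrite lte_fin expR_gt0.
  have := @integral_cst _ _ R lebesgue_measure _
    (measurable_itv `]0, 1]) (expR (- 1))%:E.
  rewrite /= lebesgue_measure_itv/= lte_fin ltr01 -EFinB subr0 mule1 => <-.
  apply: (@le_trans _ _
    (\int[lebesgue_measure]_(t in `]0%R, 1%R]) (f t)%:E)%E).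
    apply: ge0_le_integral => //= [|t].
    - exact: mf.
    - rewrite in_itv/= => /andP[t0 t1]; rewrite lee_fin.
      rewrite -[leLHS]mul1r ler_pM ?expR_ge0// ?ler_expR ?lerN2//.
      by rewrite -[leLHS](powRr0 t) ger_powR ?t0// subr_le0.
  apply: ge0_subset_integral => //; first exact: mf.
    by move=> t _; rewrite lee_fin.
  by rewrite U; apply: subsetUl.
rewrite U ge0_integral_setU//; last 3 first.
- exact: mf.
- by move=> t _; rewrite lee_fin; exact: f_ge0.
- apply/disj_set2P; rewrite -subset0 => t [] /=; rewrite !in_itv/= andbT.
  by move=> /andP[_ t1]; rewrite ltNge t1.
apply: (@le_lt_trans _ _ ((a^-1)%:E + (expR (- 1))%:E)%E); last first.
  by rewrite -EFinD ltry.
apply: leeD.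
  apply: le_trans (integral_powR_itv01 _ a0).
  apply: ge0_le_integral => //= [t _|||t].
  - by rewrite lee_fin; exact: f_ge0.
  - exact: mf.
  - by apply/measurable_EFinP; apply: measurable_funTS; exact: measurable_powR.
  - rewrite in_itv/= => /andP[t0 t1]; rewrite lee_fin.
    by rewrite ler_piMr ?powR_ge0// -expR0 ler_expR oppr_le0 ltW.
rewrite -integral_expRN_itvcy -integral_itv_obnd_cbnd//; last first.
  by apply/measurable_EFinP; exact: measurable_expRN.
apply: ge0_le_integral => //= [t _|||t].
- by rewrite lee_fin; exact: f_ge0.
- exact: mf.
- by apply/measurable_EFinP; exact: measurable_expRN.
- rewrite in_itv/= andbT => t1; rewrite lee_fin.
  rewrite ler_piMl ?expR_ge0//.
  by rewrite -[leRHS](powRr0 t) ler_powR ?subr_le0// ltW.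
Qed.

End GammaPos.

Lemma Gamma_pos1 {R : realType} : Gamma_pos (1 : R) = 1.
Proof.
rewrite /Gamma_pos /Rintegral.
under eq_integral do rewrite subrr powRr0 mul1r.
rewrite integral_itv_obnd_cbnd ?integral_expRN_itvcy ?oppr0 ?expR0//.
by apply/measurable_EFinP; exact: measurable_expRN.
Qed.

Lemma Gamma1 {R : realType} : Gamma (1 : R) = 1.
Proof. by rewrite /Gamma ltr01 Gamma_pos1. Qed.

(** Here floor (-n) = - (k + 1), and shifting -n by k + 1 lands in ]0, 1[, where
    Euler's integral is positive. *)
Lemma Gamma_opp_neq0 {R : realType} (n : R) (k : nat) :
  k%:R < n < k.+1%:R -> Gamma (- n) != 0.
Proof.
move=> /andP[kn nk].
have fl : Num.floor (- n) = - k.+1%:Z.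
  apply: floor_def; rewrite intrD1 mulrNz -pmulrn.
  by move: nk; rewrite -natr1; lra.
have n0 : 0 < n by exact: le_lt_trans kn.
rewrite /Gamma oppr_gt0 ltNge (ltW n0)/= fl abszN absz_nat.
rewrite mulf_neq0//; first by rewrite gt_eqF// Gamma_pos_gt0// -natr1; lra.
rewrite invr_eq0; apply/prodf_neq0 => i _.
rewrite addrC subr_eq0 lt_eqF// (le_lt_trans _ kn)// ler_nat.
by rewrite -ltnS ltn_ord.
Qed.

(** * The fractional system *)

(** The term j = k has the coefficient 1^{(-n-1)} / Gamma (-n), with a raising
    power, and 1^{(-n-1)} = Gamma (-n) / Gamma 1. *)
Lemma nabla_recr {R : realType} {m} (n : R) (Y : nat -> 'cV[R]_m) k :
    Gamma (- n) != 0 ->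
  nabla n Y k = Y k + (Gamma (- n))^-1 *:
    \sum_(0 <= j < k) raising_power (k - j + 1)%:R (- n - 1) *: Y j.
Proof.
move=> Gn0; rewrite /nabla /nabla_sum big_nat_recr//= scalerDr addrC.
congr (_ + _); rewrite subnn add0n /raising_power addrC subrK Gamma1 divr1.
by rewrite scalerA mulVf// scale1r.
Qed.

Lemma horner_pencil_poly {R : realType} {m} (F G : 'M[R]_m) s :
  (pencil_poly F G).[s] = \det (s *: F - G).
Proof.
rewrite /pencil_poly -/(horner_eval s _) -det_map_mx; congr (\det _).
by apply/matrixP => i j; rewrite !mxE /= /horner_eval !hornerE.
Qed.

(** Strong induction on k: by [nabla_recr] the equation at time k is a linear
    system for Y_k with the invertible matrix F - G, whose right-hand side
    involves only V_k and earlier states. *)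
Lemma fractional_causal {R : realType} {m} (n : R) (F G : 'M[R]_m) :
    Gamma (- n) != 0 -> ~ finite_eigenvalue F G 1 ->
  causal_state (fractional_system n F G).
Proof.
move=> Gn0 /negP; rewrite /root horner_pencil_poly scale1r => FG0.
have uFG : F - G \in unitmx by rewrite unitmxE unitfE.
move=> Y V Y' V' YV YV' Y0 k _ VV'.
elim/ltn_ind: k VV' => -[//|k] IHk VV'.
apply: (can_inj (mulKmx uFG)).
have lead Z U : fractional_system n F G Z U -> (F - G) *m Z k.+1 =
    U k.+1 - F *m ((Gamma (- n))^-1 *:
    \sum_(0 <= j < k.+1) raising_power (k.+1 - j + 1)%:R (- n - 1) *: Z j).
  move=> /(_ k.+1 isT); rewrite nabla_recr// mulmxDr mulmxBl => E.
  by rewrite -[U k.+1](addKr (G *m Z k.+1)) -E addrA addrK addrC.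
rewrite (lead _ _ YV) (lead _ _ YV') VV'//; congr (_ - _ *m (_ *: _)).
apply: eq_big_nat => j /andP[_ jk]; rewrite IHk// => i ij.
by rewrite VV'// (leq_trans ij)// ltnW.
Qed.

Theorem proposition3p1 (R : realType) (m l p q qs : nat)
    (F G : 'M[R]_m) (C : 'M[R]_(l, m))
    (P1 : 'M[R]_(p, m)) (P2 : 'M[R]_(q, m))
    (Qp : 'M[R]_(m, p)) (Qq : 'M[R]_(m, q))
    (J : 'M[R]_p) (H : 'M[R]_q)
    (detF : \det F = 0) (regFG : regular_pencil F G)
    (weierFG : weierstrass F G P1 P2 Qp Qq J H qs) :
  [/\ (* (a) *)
      forall W : set 'cV[R]_m, W 0 ->
        causal_state (restrict_input (singular_system F G) (inputs_in W)) <->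
        exists (r1 : nat) (B : 'M[R]_(m, r1)),
          inputs_in W `<=` inputs_through B /\ H *m P2 *m B = 0,
      (* (b) *)
      forall (r1 : nat) (B : 'M[R]_(m, r1)),
        causal_output C
          (restrict_input (singular_system F G) (inputs_through B)) <->
        (forall j, C *m col j
          (\mxrow_(i < qs.-1) (Qq *m H ^+ i.+1 *m P2 *m B)) = 0) &
      (* (c) *)
      forall n : R, (0 < n < 1) \/ (1 < n < 2) ->
        ~ finite_eigenvalue F G 1 ->
        causal_state (fractional_system n F G)].
Proof.
have [Zp [Zq FG]] := weierstrass_split weierFG.
have [qs0 Hqs _] := weier_index weierFG.
split=> [W W0|r1 B|n nI]; last first.
- apply: fractional_causal.
  by case: nI; [exact: (Gamma_opp_neq0 n 0)|exact: (Gamma_opp_neq0 n 1)].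
- rewrite inputs_throughE.
  have W0 : range (mulmx B) (0 : 'cV[R]_m) by exists 0 => //; rewrite mulmx0.
  apply: (iff_trans (causal_outputP FG C _ qs Hqs W0)).
  apply: iff_trans (iff_sym (mulmx_col_mxrow_eq0 C _)).
  split=> [CW i|CB w [u _ <-] i].
    apply/mulmx_cV_eq0 => u; rewrite -!mulmxA.
    by apply: CW; exists u.
  have [iqs|qsi] := ltnP i qs.-1.
    by have /mulmx_cV_eq0/(_ u) := CB (Ordinal iqs); rewrite -!mulmxA.
  (* The block matrix stops at H^(qs-1), beyond which the powers vanish. *)
  have qsi1 : (qs <= i.+1)%N by rewrite (leq_trans (leqSpred qs)).
  have -> : H ^+ i.+1 = 0 by rewrite -(subnK qsi1) exprD Hqs mulr0.
  by rewrite mul0mx !mulmx0.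
apply: (iff_trans (iff_sym (causal_output1 _))).
apply: (iff_trans (causal_outputP FG _ _ qs Hqs W0)).
have [B [HB Bker]] := kernel_through (H *m P2).
split=> [CW|[r [D [WD HD]]] w Ww i].
  exists m, B; split=> // V WV; rewrite inputs_throughE => k; apply: Bker.
  have := congr1 (mulmx Zq) (CW _ (WV k) 0%N).
  by rewrite mul1mx mulmx0 !mulmxA (split_qq FG) mul1mx expr1.
(* A constant sequence is an admissible input, so W lies in the range of D. *)
have [U wU] : inputs_through D (fun=> w) by apply: WD => k.
have Hw : H *m (P2 *m w) = 0 by rewrite (wU 0%N) !mulmxA HD mul0mx.
by rewrite exprSr -mulmxE -(mulmxA (H ^+ i)) Hw !mulmx0.
Qed.
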